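(* Let $(S,=,\#)$ be a set with apartness, $(T,=,\#;\sigma)$ a co-quasiordered set with apartness, and $f:S\to T$ an se-mapping. Then: (i) $\mu_f$ is a co-quasiorder on $S$; (ii) $\kappa_f=\mu_f\cup\mu_f^{-1}$ is a co-equivalence on $S$ with $\kappa_f\subseteq\mathrm{coker}\,f$; (iii) if $\sigma$ is a co-order on $T$, then $\kappa_f=\mathrm{coker}\,f$; (iv) $(S/\kappa_f^c,=,\#;\Upsilon_f)$ is a co-ordered set with apartness, where $(x\kappa_f^c,y\kappa_f^c)\in\Upsilon_f\iff(x,y)\in\mu_f$; (v) the mapping $\psi:S/\kappa_f^c\to T/\kappa_\sigma^c$, $\psi(x\kappa_f^c)=f(x)\kappa_\sigma^c$, between the co-ordered sets with apartness $(S/\kappa_f^c,\Upsilon_f)$ and $(T/\kappa_\sigma^c,\Upsilon_\sigma)$ is an isotone and reverse isotone a-injective se-mapping such that $\psi\pi_f=\pi_\sigma f$.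
   Context: Constructive (Bishop-style) setting. A set with apartness: inhabited set with equality $=$ (an equivalence) and $\#$ with $\neg(x\#x)$, $x\#y\Rightarrow y\#x$, $x\#z\Rightarrow\forall y(x\#y\vee y\#z)$, extensional w.r.t. $=$; $S\times S$ has apartness $(s,t)\#(u,v)\iff s\#u\vee t\#v$. A relation $\alpha$ is strongly irreflexive if $(x,y)\in\alpha\Rightarrow x\#y$; co-transitive if $(x,y)\in\alpha\Rightarrow\forall z((x,z)\in\alpha\vee(z,y)\in\alpha)$; co-antisymmetric if $x\#y\Rightarrow(x,y)\in\alpha\vee(y,x)\in\alpha$. Co-quasiorder: strongly irreflexive and co-transitive; co-equivalence: symmetric co-quasiorder; co-order: co-antisymmetric co-quasiorder. A (co-quasi)ordered set with apartness is a set with apartness with a co-quasiorder (co-order). For a co-quasiorder $\kappa$, $\kappa^c={\sim}\kappa=\{(x,y):\forall(a,b)\in\kappa\,((x,y)\#(a,b))\}$ (equal to the logical complement). For a co-equivalence $\kappa$ on $S$, $S/\kappa^c$ has equality $x\kappa^c=y\kappa^c\iff(x,y)\in\kappa^c$ and apartness $x\kappa^c\#y\kappa^c\iff(x,y)\in\kappa$. Mappings are extensional functions; se-mapping: $f(x)\#f(y)\Rightarrow x\#y$; a-injective: $x\#y\Rightarrow f(x)\#f(y)$. $\mathrm{coker}\,f=\{(x,y):f(x)\#f(y)\}$; $\mu_f=\{(x,y)\in S\times S:(f(x),f(y))\in\sigma\}$; $\kappa_\sigma=\sigma\cup\sigma^{-1}$ and $(u\kappa_\sigma^c,v\kappa_\sigma^c)\in\Upsilon_\sigma\iff(u,v)\in\sigma$.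 $\pi_f:S\to S/\kappa_f^c$ and $\pi_\sigma:T\to T/\kappa_\sigma^c$ are the quotient maps. A map $g$ between sets with relations $\alpha,\beta$ is isotone if $(x,y)\in\alpha\Rightarrow(g(x),g(y))\in\beta$, reverse isotone if the converse implication holds. *)

(* Defs.v *)
From Stdlib Require Export Relations.
From Stdlib Require Import Setoid Morphisms.

(** Constructive (Bishop-style) sets with apartness, over plain [Stdlib]
    relations [relation A = A -> A -> Prop]. *)

(** Data only; the axioms are [set_with_apartness].  Keeping them apart lets one
    form the quotient [quot S k] and then assert that it is a set with
    apartness. *)
Record apart_struct : Type := ApartStruct {
  carrier :> Type;
  eqv : relation carrier;
  apt : relation carrier
}.

Arguments eqv {_} _ _.
Arguments apt {_} _ _.

Notation "x == y" := (eqv x y) (at level 70, no associativity).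
Notation "x # y" := (apt x y) (at level 70, no associativity).

(** The apartness is not assumed to be tight. *)
Record set_with_apartness (S : apart_struct) : Prop := {
  swa_inhabited : inhabited S;
  swa_equivalence : Equivalence (@eqv S);
  swa_irreflexive : forall x : S, ~ (x # x);
  swa_symmetric : forall x y : S, x # y -> y # x;
  swa_cotransitive : forall x z : S, x # z -> forall y : S, x # y \/ y # z;
  swa_extensional : Proper (@eqv S ==> @eqv S ==> iff) (@apt S)
}.

Definition prod_apart (S T : apart_struct) : apart_struct :=
  {| carrier := (S * T)%type;
     eqv := fun p q => fst p == fst q /\ snd p == snd q;
     apt := fun p q => fst p # fst q \/ snd p # snd q |}.

Definition strongly_irreflexive (S : apart_struct) (a : relation S) : Prop :=
  forall x y : S, a x y -> x # y.

Definition co_transitive (S : apart_struct) (a : relation S) : Prop :=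
  forall x y : S, a x y -> forall z : S, a x z \/ a z y.

Definition co_antisymmetric (S : apart_struct) (a : relation S) : Prop :=
  forall x y : S, x # y -> a x y \/ a y x.

Definition co_quasiorder (S : apart_struct) (a : relation S) : Prop :=
  strongly_irreflexive S a /\ co_transitive S a.

Definition co_equivalence (S : apart_struct) (a : relation S) : Prop :=
  symmetric S a /\ co_quasiorder S a.

Definition co_order (S : apart_struct) (a : relation S) : Prop :=
  co_antisymmetric S a /\ co_quasiorder S a.

Definition co_quasiordered_set (S : apart_struct) (a : relation S) : Prop :=
  set_with_apartness S /\ co_quasiorder S a.

Definition co_ordered_set (S : apart_struct) (a : relation S) : Prop :=
  set_with_apartness S /\ co_order S a.

(** A relation on [S] is a subset of [S * S], hence should respect [==].  For
    co-quasiorders this need not be required separately. *)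
Lemma co_quasiorder_extensional (S : apart_struct) (a : relation S) :
  set_with_apartness S -> co_quasiorder S a ->
  Proper (@eqv S ==> @eqv S ==> iff) a.
Proof.
intros [_ Heq Hirr _ _ Hext] [Hsi Hct].
assert (H : forall x y : S, x == y -> ~ a x y).
{ intros x y Hxy Ha. apply (Hirr y).
  apply (Hext x y Hxy y y (reflexivity y)). exact (Hsi x y Ha). }
assert (G : forall x x' y y' : S, x == x' -> y == y' -> a x y -> a x' y').
{ intros x x' y y' Hx Hy Ha.
  destruct (Hct x y Ha x') as [H1 | H1]; [now destruct (H x x' Hx)|].
  destruct (Hct x' y H1 y') as [H2 | H2]; [exact H2|].
  now destruct (H y' y (symmetry Hy)). }
intros x x' Hx y y' Hy; split; intro Ha.
- exact (G x x' y y' Hx Hy Ha).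
- exact (G x' x y' y (symmetry Hx) (symmetry Hy) Ha).
Qed.

(** [k^c]: the pairs that are apart, in [S * S], from every pair of [k]. *)
Definition a_complement (S : apart_struct) (k : relation S) : relation S :=
  fun x y => forall a b : S, k a b -> @apt (prod_apart S S) (x, y) (a, b).

(** A mapping is extensional for [==]; as apartness need not be tight, this does
    not follow from strong extensionality. *)
Definition mapping (S T : apart_struct) (f : S -> T) : Prop :=
  Proper (@eqv S ==> @eqv T) f.

Definition strongly_extensional (S T : apart_struct) (f : S -> T) : Prop :=
  forall x y : S, f x # f y -> x # y.

Definition se_mapping (S T : apart_struct) (f : S -> T) : Prop :=
  mapping S T f /\ strongly_extensional S T f.

Definition a_injective (S T : apart_struct) (f : S -> T) : Prop :=
  forall x y : S, x # y -> f x # f y.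

Definition isotone (S T : apart_struct) (a : relation S) (b : relation T)
    (g : S -> T) : Prop :=
  forall x y : S, a x y -> b (g x) (g y).

Definition reverse_isotone (S T : apart_struct) (a : relation S) (b : relation T)
    (g : S -> T) : Prop :=
  forall x y : S, b (g x) (g y) -> a x y.

Definition coker (S T : apart_struct) (f : S -> T) : relation S :=
  fun x y => f x # f y.

Definition mu (S T : apart_struct) (sigma : relation T) (f : S -> T) : relation S :=
  fun x y => sigma (f x) (f y).

Definition kappa (S : apart_struct) (r : relation S) : relation S :=
  union S r (transp S r).

(** As usual for Bishop sets, an element of a quotient is presented by a
    representative ([qclass x] is the class of [x]) and only the equality
    changes.  The parameter [e] is the equivalence one quotients by. *)
Record quot_carrier (A : Type) (e : relation A) : Type := QClass { qrep : A }.

Arguments QClass {A} e _.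
Arguments qrep {A e} _.

(** [S / k^c]. *)
Definition quot (S : apart_struct) (k : relation S) : apart_struct :=
  {| carrier := quot_carrier S (a_complement S k);
     eqv := fun p q => a_complement S k (qrep p) (qrep q);
     apt := fun p q => k (qrep p) (qrep q) |}.

Definition qclass (S : apart_struct) (k : relation S) (x : S) : quot S k :=
  QClass (a_complement S k) x.

(** The relation induced by [r] on the quotient by the complement of
    [kappa S r]; it gives both [Upsilon_sigma] (for [r = sigma]) and [Upsilon_f]
    (for [r = mu S T sigma f]). *)
Definition Upsilon (S : apart_struct) (r : relation S) :
    relation (quot S (kappa S r)) :=
  fun p q => r (qrep p) (qrep q).

Definition psi (S T : apart_struct) (sigma : relation T) (f : S -> T)
    (p : quot S (kappa S (mu S T sigma f))) : quot T (kappa T sigma) :=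
  qclass T (kappa T sigma) (f (qrep p)).

(* Main.v *)
From Stdlib Require Import Setoid Morphisms.
Require Import Defs.

(** The complement of a co-quasiorder [k] is its logical complement: given
    [~ k x y] and [k a b], co-transitivity through [x] and then [y] yields
    [k a x] or [k y b], so that [(x, y)] and [(a, b)] are apart.  Thus, by
    co-transitivity again, a co-equivalence becomes an apartness on its
    quotient. *)

Lemma a_complement_iff (S : apart_struct) (k : relation S) :
  set_with_apartness S -> co_quasiorder S k ->
  forall x y : S, a_complement S k x y <-> ~ k x y.
Proof.
intros hS [hsi hct] x y; split.
- intros hc hk.
  destruct (hc x y hk) as [H | H]; exact (swa_irreflexive _ hS _ H).
- intros hn a b hab; simpl.
  destruct (hct a b hab x) as [hax | hxb].
  + left. exact (swa_symmetric _ hS _ _ (hsi _ _ hax)).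
  + destruct (hct x b hxb y) as [hxy | hyb].
    * contradiction.
    * right. exact (hsi _ _ hyb).
Qed.

Lemma co_quasiorder_irreflexive (S : apart_struct) (k : relation S) :
  set_with_apartness S -> co_quasiorder S k -> forall x : S, ~ k x x.
Proof.
intros hS [hsi _] x hx. exact (swa_irreflexive _ hS x (hsi _ _ hx)).
Qed.

Lemma co_quasiorder_mu (S T : apart_struct) (sigma : relation T) (f : S -> T) :
  co_quasiorder T sigma -> strongly_extensional S T f ->
  co_quasiorder S (mu S T sigma f).
Proof.
intros [hsi hct] hf; split.
- intros x y h. exact (hf x y (hsi _ _ h)).
- intros x y h z. exact (hct _ _ h (f z)).
Qed.

Lemma co_equivalence_kappa (S : apart_struct) (r : relation S) :
  set_with_apartness S -> co_quasiorder S r -> co_equivalence S (kappa S r).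
Proof.
intros hS [hsi hct]; repeat split.
- intros x y [h | h]; [right | left]; exact h.
- intros x y [h | h].
  + exact (hsi _ _ h).
  + exact (swa_symmetric _ hS _ _ (hsi _ _ h)).
(* If [h] is [r y x], the alternatives [r y z] and [r z x] are transposed instances for [(z, y)] and
   [(x, z)], so they serve the disjuncts in swapped order. *)
- intros x y [h | h] z; destruct (hct _ _ h z) as [h' | h'].
  + left; left; exact h'.
  + right; left; exact h'.
  + right; right; exact h'.
  + left; right; exact h'.
Qed.

(** Once equality is read as the negation of [k], its transitivity is the contrapositive of
    co-transitivity. *)
Lemma quot_set_with_apartness (S : apart_struct) (k : relation S) :
  set_with_apartness S -> co_equivalence S k -> set_with_apartness (quot S k).
Proof.
intros hS [hsym hk].
pose proof (a_complement_iff S k hS hk) as hc.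
pose proof (co_quasiorder_irreflexive S k hS hk) as hirr.
destruct hk as [_ hct].
assert (heqv : Equivalence (@eqv (quot S k))).
{ split.
  - intros p. apply hc, hirr.
  - intros p q hpq. apply hc in hpq. apply hc.
    intro h. exact (hpq (hsym _ _ h)).
  - intros p q s hpq hqs. apply hc in hpq, hqs. apply hc.
    intro h. destruct (hct _ _ h (qrep q)); contradiction. }
(* Co-transitivity replaces one endpoint at a time; the unwanted branches [k p p'] and [k q' q]
   contradict the equalities. *)
assert (happ : forall p p' q q' : quot S k,
           p == p' -> q == q' -> p # q -> p' # q').
{ intros p p' q q' hp hq h. apply hc in hp, hq.
  destruct (hct _ _ h (qrep p')) as [h1 | h1]; [contradiction |].
  destruct (hct _ _ h1 (qrep q')) as [h2 | h2]; [exact h2 |].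
  destruct (hq (hsym _ _ h2)). }
split.
- destruct (swa_inhabited _ hS) as [x]. exact (inhabits (qclass S k x)).
- exact heqv.
- intro p. apply hirr.
- intros p q. apply hsym.
- intros p q h s. exact (hct _ _ h (qrep s)).
- intros p p' hp q q' hq; split; apply happ; try assumption; symmetry; assumption.
Qed.

(** The quotient's apartness is [r] joined with its transpose, which is exactly what co-antisymmetry
    of the induced relation asks for. *)
Lemma co_ordered_set_Upsilon (S : apart_struct) (r : relation S) :
  set_with_apartness S -> co_quasiorder S r ->
  co_ordered_set (quot S (kappa S r)) (Upsilon S r).
Proof.
intros hS hr; split.
- apply quot_set_with_apartness, co_equivalence_kappa; assumption.
- destruct hr as [_ hct]; repeat split.
  + intros p q h. exact h.
  + intros p q h. left. exact h.
  + intros p q h s. exact (hct _ _ h (qrep s)).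
Qed.

Theorem theorem17 (S T : apart_struct) (sigma : relation T) (f : S -> T)
    (hS : set_with_apartness S)
    (hT : co_quasiordered_set T sigma)
    (hf : se_mapping S T f) :
  let mu_f := mu S T sigma f in
  let kappa_f := kappa S mu_f in
  let kappa_sigma := kappa T sigma in
  let Upsilon_f := Upsilon S mu_f in
  let Upsilon_sigma := Upsilon T sigma in
  let pi_f := qclass S kappa_f in
  let pi_sigma := qclass T kappa_sigma in
  let psi_f := psi S T sigma f in
  (* i *)
  co_quasiorder S mu_f
  (* ii *)
  /\ (co_equivalence S kappa_f /\ inclusion S kappa_f (coker S T f))
  (* iii *)
  /\ (co_order T sigma -> same_relation S kappa_f (coker S T f))
  (* iv *)
  /\ co_ordered_set (quot S kappa_f) Upsilon_f
  (* v *)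
  /\ (co_ordered_set (quot T kappa_sigma) Upsilon_sigma
      /\ se_mapping (quot S kappa_f) (quot T kappa_sigma) psi_f
      /\ a_injective (quot S kappa_f) (quot T kappa_sigma) psi_f
      /\ isotone (quot S kappa_f) (quot T kappa_sigma)
           Upsilon_f Upsilon_sigma psi_f
      /\ reverse_isotone (quot S kappa_f) (quot T kappa_sigma)
           Upsilon_f Upsilon_sigma psi_f
      /\ (forall x : S, psi_f (pi_f x) == pi_sigma (f x))).
Proof.
intros mu_f kappa_f kappa_sigma Upsilon_f Upsilon_sigma pi_f pi_sigma psi_f.
destruct hT as [hT hsigma], hf as [_ hse].
assert (hmu : co_quasiorder S mu_f) by (apply co_quasiorder_mu; assumption).
assert (hkf : co_equivalence S kappa_f)
  by (apply co_equivalence_kappa; assumption).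
assert (hks : co_equivalence T kappa_sigma)
  by (apply co_equivalence_kappa; assumption).
(* [kappa_f x y] unfolds to [kappa_sigma (f x) (f y)], so this is strong irreflexivity of
   [kappa_sigma]. *)
assert (hcoker : inclusion S kappa_f (coker S T f))
  by (intros x y h; exact (proj1 (proj2 hks) (f x) (f y) h)).
assert (hQT : co_ordered_set (quot T kappa_sigma) Upsilon_sigma)
  by (apply co_ordered_set_Upsilon; assumption).
split; [exact hmu |].
split; [exact (conj hkf hcoker) |].
split.
{ intros [hca _]; split; [exact hcoker |].
  intros x y h. exact (hca _ _ h). }
split; [apply co_ordered_set_Upsilon; assumption |].
split; [exact hQT |].
(* [psi_f] acts on representatives as [f], and [mu_f], [kappa_f] are the
   preimages of [sigma], [kappa_sigma] under [f]: the remaining conditions on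
   relations hold by conversion. *)
repeat split.
(* The equalities quantify over pairs of [S] and of [T] respectively, so they do not match by
   conversion; their logical forms [~ kappa_f] and [~ kappa_sigma] do. *)
- intros p q h.
  apply (a_complement_iff T kappa_sigma hT (proj2 hks)).
  exact (proj1 (a_complement_iff S kappa_f hS (proj2 hkf) _ _) h).
- intros p q h. exact h.
- intros p q h. exact h.
- intros p q h. exact h.
- intros p q h. exact h.
(* Both sides are the class of [f x], so reflexivity suffices. *)
- intro x. apply (swa_equivalence _ (proj1 hQT)).
Qed.
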